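(* Let $H,K$ be Hilbert spaces, and let $T_1$ (on $H$), $T_3$ (from $D(T_3)\subset H$ into $K$) and $T_4$ (on $K$) be densely defined closed operators with closed ranges such that $R(T_1^{*})\oplus^{\perp}R(T_3^{*})=H$ (orthogonal direct sum) and $R(T_3)\perp R(T_4)$ in $K$. Let $S=T_1^{*}T_1+T_3^{*}T_3$ with domain $D(S)=D(T_1^{*}T_1)\cap D(T_3^{*}T_3)$, and assume $D(S)$ is dense in $H$. Let $T=\begin{bmatrix}T_1 & 0\\ T_3 & T_4\end{bmatrix}$ be the operator on $H\bigoplus K$ with domain $(D(T_1)\cap D(T_3))\bigoplus D(T_4)$ given by $T(x_1,x_2)=(T_1x_1,\,T_3x_1+T_4x_2)$. Then $T^{\dagger}$ exists and $$T^{\dagger}=\begin{bmatrix}T_1^{\dagger} & T_3^{\dagger}\\ 0 & T_4^{\dagger}\end{bmatrix}=\begin{bmatrix}\overline{S^{\dagger}T_1^{*}} & \overline{S^{\dagger}T_3^{*}}\\ 0 & T_4^{\dagger}\end{bmatrix}.$$ Moreover, $w(T)=\begin{bmatrix}w(T_1) & 0\\ w(T_3) & w(T_4)\end{bmatrix}$.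
   Context: $H\bigoplus K$ is the Hilbert direct sum. For a closed operator $A$ with closed range, $C(A)=D(A)\cap N(A)^{\perp}$ and the Moore–Penrose inverse $A^{\dagger}$ is defined on $R(A)\oplus^{\perp}R(A)^{\perp}$ by $A^{\dagger}y=(A|_{C(A)})^{-1}y$ for $y\in R(A)$ and $A^{\dagger}y=0$ for $y\in R(A)^{\perp}$. The generalized Cauchy dual of a densely defined closed operator $A$ is $w(A)=A(A^{*}A)^{\dagger}$ (products on natural domains). $\overline{B}$ denotes the closure of a closable operator $B$. *)

(* Defs.v *)
From mathcomp Require Import all_boot all_algebra.
From mathcomp Require Import complex.
From mathcomp Require Import classical_sets reals.
Set Implicit Arguments. Unset Strict Implicit. Unset Printing Implicit Defensive.
Import GRing.Theory Num.Theory.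
Local Open Scope ring_scope.

Record op (U V : Type) := Op { dom : U -> Prop; app : U -> V }.
Arguments Op {U V}.
Arguments dom {U V}.
Arguments app {U V}.

Section Hilbert.
Variable R : realType.
Local Notation C := R[i].

Section OneSpace.
Variable U : lmodType C.
Variable ip : U -> U -> C.  (* linear in the first, conjugate-linear in the second argument *)

Definition nsq (x : U) : C := ip x x.

Definition cvg_to (u : nat -> U) (x : U) : Prop :=
  forall e : C, 0 < e -> exists N, forall n, (N <= n)%N -> nsq (u n - x) < e.

Definition cauchy (u : nat -> U) : Prop :=
  forall e : C, 0 < e -> exists N, forall m n, (N <= m)%N -> (N <= n)%N ->
    nsq (u m - u n) < e.

Definition is_hilbert : Prop :=
  [/\ forall (a : C) (x y z : U), ip (a *: x + y) z = a * ip x z + ip y z,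
      forall x y : U, ip y x = (ip x y)^*,
      forall x : U, 0 <= ip x x,
      forall x : U, ip x x = 0 -> x = 0
    & forall u : nat -> U, cauchy u -> exists x, cvg_to u x].

Definition dense (D : U -> Prop) : Prop :=
  forall (x : U) (e : C), 0 < e -> exists y, D y /\ nsq (x - y) < e.

Definition closed_set (M : U -> Prop) : Prop :=
  forall (u : nat -> U) (x : U), (forall n, M (u n)) -> cvg_to u x -> M x.

Definition orth (M : U -> Prop) : U -> Prop :=
  fun y => forall x, M x -> ip x y = 0.

Definition perp (M N : U -> Prop) : Prop := forall x y, M x -> N y -> ip x y = 0.

Definition orth_dsum_full (M N : U -> Prop) : Prop :=
  perp M N /\ forall x, exists a b, M a /\ N b /\ x = a + b.
End OneSpace.

Definition ip_sum (H K : lmodType C) (ipH : H -> H -> C) (ipK : K -> K -> C)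
  (x y : H * K) : C := ipH x.1 y.1 + ipK x.2 y.2.

Section Ops.
Variables U V W : lmodType C.
Variables (ipU : U -> U -> C) (ipV : V -> V -> C).

Definition linop (T : op U V) : Prop :=
  dom T 0 /\ forall (a : C) (x y : U), dom T x -> dom T y ->
    dom T (a *: x + y) /\ app T (a *: x + y) = a *: app T x + app T y.

Definition densely_defined (T : op U V) : Prop := dense ipU (dom T).

Definition closed_op (T : op U V) : Prop :=
  forall (u : nat -> U) (x : U) (y : V), (forall n, dom T (u n)) ->
    cvg_to ipU u x -> cvg_to ipV (fun n => app T (u n)) y ->
    dom T x /\ app T x = y.

Definition closable (T : op U V) : Prop :=
  forall (u : nat -> U) (y : V), (forall n, dom T (u n)) ->
    cvg_to ipU u 0 -> cvg_to ipV (fun n => app T (u n)) y -> y = 0.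

Definition closure_graph (T : op U V) (x : U) (y : V) : Prop :=
  exists u : nat -> U, (forall n, dom T (u n)) /\
    cvg_to ipU u x /\ cvg_to ipV (fun n => app T (u n)) y.

Definition op_closure (T : op U V) : op U V :=
  Op (fun x => exists y, closure_graph T x y)
     (fun x => xget 0 (fun y => closure_graph T x y)).

Definition op_range (T : op U V) : V -> Prop := fun y => exists x, dom T x /\ app T x = y.
Definition kernel (T : op U V) : U -> Prop := fun x => dom T x /\ app T x = 0.

Definition closed_range (T : op U V) : Prop := closed_set ipV (op_range T).

Definition carrier (T : op U V) : U -> Prop :=
  fun x => dom T x /\ orth ipU (kernel T) x.

Definition adj_rel (T : op U V) (y : V) (z : U) : Prop :=
  forall x, dom T x -> ipV (app T x) y = ipU x z.

Definition adjoint (T : op U V) : op V U :=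
  Op (fun y => exists z, adj_rel T y z) (fun y => xget 0 (adj_rel T y)).

Definition mp_rel (T : op U V) (y : V) (x : U) : Prop :=
  carrier T x /\ exists b, orth ipV (op_range T) b /\ y = app T x + b.

Definition mp_inv (T : op U V) : op V U :=
  Op (fun y => exists a b, op_range T a /\ orth ipV (op_range T) b /\ y = a + b)
     (fun y => xget 0 (mp_rel T y)).

Definition op_eq (A B : op U V) : Prop :=
  (forall x, dom A x <-> dom B x) /\ (forall x, dom A x -> app A x = app B x).

Definition zero_op : op U V := Op (fun _ => True) (fun _ => 0).

Definition op_add (A B : op U V) : op U V :=
  Op (fun x => dom A x /\ dom B x) (fun x => app A x + app B x).
End Ops.

Definition op_mul (U V W : Type) (A : op V W) (B : op U V) : op U W :=
  Op (fun x => dom B x /\ dom A (app B x)) (fun x => app A (app B x)).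

Definition blk (U1 U2 V1 V2 : lmodType C)
  (A : op U1 V1) (B : op U2 V1) (C' : op U1 V2) (D : op U2 V2) : op (U1 * U2) (V1 * V2) :=
  Op (fun x => [/\ dom A x.1, dom B x.2, dom C' x.1 & dom D x.2])
     (fun x => (app A x.1 + app B x.2, app C' x.1 + app D x.2)).

Definition cdual (U V : lmodType C) (ipU : U -> U -> C) (ipV : V -> V -> C)
  (A : op U V) : op U V :=
  op_mul A (mp_inv ipU ipU (op_mul (adjoint ipU ipV A) A)).
End Hilbert.

(* Main.v *)
(* Put [M = R(T1^* )] and [N = R(T3^* )].  Since [M] and [N] are orthogonal and span [H],
   [N = N(T1)] and [M = N(T3)]: [T1] lives on [M] and vanishes on [N], and [T3] the other way
   round.  Hence [S] is the direct sum of [T1^* T1] on [M] and [T3^* T3] on [N]; because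
   [R(T1^* T1) = R(T1^* )] (closed range), [S] is a bijection of [D(S)] onto [H].  Solving
   [S x = T1^* y] gives [T1^* T1 x = T1^* y] with [x] in [M], i.e. [x = T1^dagger y], so that
   [S^dagger T1^*] is the restriction of [T1^dagger] to [D(T1^* )]; it is dense in the graph of
   [T1^dagger] because [D(T1^* T1)] is a core of [T1], which spares any use of the closed graph
   theorem.  Orthogonality of [R(T3)] and [R(T4)] makes [T^* T] the diagonal operator with
   entries [S] and [T4^* T4], from which [w(T)] is computed. *)

Require Import Defs.
From mathcomp Require Import all_boot all_order all_algebra.
From mathcomp Require Import complex.
From mathcomp Require Import boolp classical_sets reals.
From mathcomp Require Import ring lra.
Set Implicit Arguments. Unset Strict Implicit. Unset Printing Implicit Defensive.
Import Order.TTheory GRing.Theory Num.Theory.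
Local Open Scope ring_scope.

(** * Hilbert spaces and orthogonal projection *)

Section SquareModulus.
Variable R : realType.

(** The order of [R[i]] is partial, so squared moduli are taken in [R], where linear arithmetic
    applies; [sqn] does the same for norms. *)
Definition sqmod (z : R[i]) : R := complex.Re (`|z| ^+ 2).
Arguments sqmod : simpl never.

Lemma sqmodE z : (sqmod z)%:C%C = `|z| ^+ 2.
Proof. by rewrite /sqmod RRe_real // rpredX // normr_real. Qed.

Lemma sqmod_ReIm z : sqmod z = complex.Re z ^+ 2 + complex.Im z ^+ 2.
Proof. by apply: complexI; rewrite sqmodE -add_Re2_Im2. Qed.

Lemma sqmod_ge0 z : 0 <= sqmod z.
Proof. by rewrite -ler0c sqmodE exprn_ge0. Qed.

Lemma sqmod_eq0 z : sqmod z <= 0 -> z = 0.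
Proof.
move=> h; have : sqmod z = 0 by apply/eqP; rewrite eq_le h sqmod_ge0.
move=> /(congr1 (real_complex R)); rewrite sqmodE => /eqP.
by rewrite expf_eq0 /= normr_eq0 => /eqP.
Qed.

Lemma eq0_small (x : R) : 0 <= x -> (forall e, 0 < e -> x < e) -> x = 0.
Proof.
move=> x0 h; apply/eqP; rewrite eq_le x0 andbT leNgt; apply/negP => /h.
by rewrite ltxx.
Qed.

Lemma inv_succ_small (e : R) : 0 < e -> exists N, forall n, (N <= n)%N -> n.+1%:R^-1 < e.
Proof.
move=> e0; exists (Num.truncn e^-1) => n Nn.
rewrite invf_plt ?posrE ?ltr0n //.
by apply: lt_le_trans (truncnS_gt _) _; rewrite ler_nat.
Qed.

Lemma sqmod0 : sqmod (0 : R[i]) = 0.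
Proof. by rewrite /sqmod normr0 expr0n. Qed.

Lemma sqmodD_le (a b : R[i]) : sqmod (a + b) <= 2 * sqmod a + 2 * sqmod b.
Proof.
rewrite !sqmod_ReIm; case: a b => [a a'] [b b'] /=.
have := sqr_ge0 (a - b); have := sqr_ge0 (a' - b'); nra.
Qed.

(** A complex number above 0 in this order is real, so the complex tolerances in the definitions of
    convergence and density become real ones. *)
Lemma epsC (e : R[i]) : 0 < e -> exists2 r : R, 0 < r & e = r%:C%C.
Proof.
move=> e0; exists (complex.Re e); last by rewrite RRe_real // gtr0_real.
by move: e0; rewrite ltcE => /andP[_].
Qed.

End SquareModulus.

Section HilbertSpace.
Variables (R : realType) (U : lmodType R[i]) (ip : U -> U -> R[i]).
Hypothesis hU : is_hilbert ip.
Implicit Types (x y z : U) (a : R[i]) (M : U -> Prop) (u v : nat -> U).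

Definition sqn x : R := complex.Re (ip x x).
Arguments sqn : simpl never.

Lemma ipDl x y z : ip (x + y) z = ip x z + ip y z.
Proof. by case: hU => h _ _ _ _; rewrite -{1}(scale1r x) h mul1r. Qed.
Lemma ip0l z : ip 0 z = 0.
Proof. by apply: (addrI (ip 0 z)); rewrite -ipDl !addr0. Qed.
Lemma ipZl a x z : ip (a *: x) z = a * ip x z.
Proof. by case: hU => h _ _ _ _; rewrite -[a *: x]addr0 h ip0l addr0. Qed.
Lemma ipNl x z : ip (- x) z = - ip x z.
Proof. by rewrite -scaleN1r ipZl mulN1r. Qed.
Lemma ipBl x y z : ip (x - y) z = ip x z - ip y z.
Proof. by rewrite ipDl ipNl. Qed.
Lemma ipC x y : ip y x = (ip x y)^*.
Proof. by case: hU. Qed.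
Lemma ipDr x y z : ip z (x + y) = ip z x + ip z y.
Proof. by rewrite ipC ipDl rmorphD /= -!(ipC _ z). Qed.
Lemma ip0r z : ip z 0 = 0.
Proof. by rewrite ipC ip0l rmorph0. Qed.
Lemma ipZr a x z : ip z (a *: x) = a^* * ip z x.
Proof. by rewrite ipC ipZl rmorphM /= -(ipC _ z). Qed.
Lemma ipNr x z : ip z (- x) = - ip z x.
Proof. by rewrite ipC ipNl rmorphN /= -(ipC _ z). Qed.
Lemma ipBr x y z : ip z (x - y) = ip z x - ip z y.
Proof. by rewrite ipDr ipNr. Qed.
Lemma ip_sym0 x y : ip x y = 0 -> ip y x = 0.
Proof. by move=> h; rewrite ipC h rmorph0. Qed.

Lemma nsq_sqn x : nsq ip x = (sqn x)%:C%C.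
Proof. by case: hU => _ _ h _ _; rewrite /sqn RRe_real // ger0_real. Qed.
Lemma sqn_ge0 x : 0 <= sqn x.
Proof. by rewrite -ler0c -nsq_sqn; case: hU => _ _ + _ _; apply. Qed.
Lemma sqn0 : sqn 0 = 0.
Proof. by rewrite /sqn ip0l. Qed.
Lemma sqn_eq0 x : sqn x = 0 -> x = 0.
Proof. by move=> h; case: hU => _ _ _ h0 _; apply: h0; rewrite -/(nsq ip x) nsq_sqn h. Qed.
Lemma sqnN x : sqn (- x) = sqn x.
Proof. by rewrite /sqn ipNl ipNr opprK. Qed.
Lemma sqnB x y : sqn (x - y) = sqn (y - x).
Proof. by rewrite -sqnN opprB. Qed.
Lemma parallelogram x y : sqn (x + y) + sqn (x - y) = 2 * sqn x + 2 * sqn y.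
Proof.
apply: complexI; rewrite !mulr_natl !(rmorphD, rmorphMn) /= -!nsq_sqn /nsq.
by rewrite !(ipDl, ipDr, ipNl, ipNr); ring.
Qed.
Lemma sqnD_le x y : sqn (x + y) <= 2 * sqn x + 2 * sqn y.
Proof. by rewrite -parallelogram lerDl sqn_ge0. Qed.
Lemma sqnDB_le x y z : sqn (x - y) <= 2 * sqn (x - z) + 2 * sqn (y - z).
Proof. by rewrite (sqnB y) -[x - y](subrKA z) sqnD_le. Qed.
Lemma pythagoras x y : ip x y = 0 -> sqn (x + y) = sqn x + sqn y.
Proof.
by move=> h; rewrite /sqn ipDl !ipDr h (ip_sym0 h) addr0 add0r raddfD.
Qed.
Lemma sqnZ a x : sqn (a *: x) = sqmod a * sqn x.
Proof.
apply: complexI; rewrite rmorphM /= sqmodE -!nsq_sqn /nsq ipZl ipZr normCK.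
by ring.
Qed.

(* Choosing [a = ip x y / nsq y] minimises [sqn (x - a *: y)]; the drop in norm is
   [sqmod (ip x y) / sqn y]. *)
Lemma ip_gap x y d : (forall a, d <= sqn (x - a *: y)) ->
  sqmod (ip x y) <= sqn y * (sqn x - d).
Proof.
move=> hd; have [y0|/eqP y0] := eqVneq (sqn y) 0.
  by rewrite y0 mul0r (sqn_eq0 y0) ip0r sqmod0.
set a := ip x y / nsq ip y.
have ypos : 0 < sqn y by rewrite lt_neqAle sqn_ge0 eq_sym andbT; apply/eqP.
have nz : nsq ip y != 0 by rewrite nsq_sqn; apply/eqP => /complexI.
suff <- : sqn y * (sqn x - sqn (x - a *: y)) = sqmod (ip x y).
  by rewrite ler_pM2l // lerB.
apply: complexI; rewrite sqmodE rmorphM rmorphB /= -!nsq_sqn {2 3}/nsq.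
rewrite !(ipDl, ipDr, ipNl, ipNr, ipZl, ipZr) normCK (ipC x y) -/(nsq ip y).
have -> : a^* = (ip x y)^* / nsq ip y.
  by rewrite /a rmorphM /= fmorphV /= /nsq -(ipC y y).
rewrite /a; move: nz; move: (nsq ip y) => N nz; by field.
Qed.

(** The case [d = 0] of [ip_gap]. *)
Lemma cauchy_schwarz x y : sqmod (ip x y) <= sqn x * sqn y.
Proof.
by rewrite mulrC -[sqn x]subr0; apply: ip_gap => a; apply: sqn_ge0.
Qed.

Lemma cvgP u x : cvg_to ip u x <->
  forall e : R, 0 < e -> exists N, forall n, (N <= n)%N -> sqn (u n - x) < e.
Proof.
split=> h e e0.
  have [|N hN] := h e%:C%C; first by rewrite ltcR.
  by exists N => n /hN; rewrite nsq_sqn ltcR.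
have [r r0 ->] := epsC e0; have [N hN] := h r r0.
by exists N => n /hN; rewrite nsq_sqn ltcR.
Qed.

Lemma cauchyP u : cauchy ip u <->
  forall e : R, 0 < e -> exists N, forall m n, (N <= m)%N -> (N <= n)%N ->
    sqn (u m - u n) < e.
Proof.
split=> h e e0.
  have [|N hN] := h e%:C%C; first by rewrite ltcR.
  by exists N => m n i j; have := hN m n i j; rewrite nsq_sqn ltcR.
have [r r0 ->] := epsC e0; have [N hN] := h r r0.
by exists N => m n i j; have := hN m n i j; rewrite nsq_sqn ltcR.
Qed.

Lemma denseP M : dense ip M <->
  forall x (e : R), 0 < e -> exists y, M y /\ sqn (x - y) < e.
Proof.
split=> h x e e0.
  have [|y [My hy]] := h x e%:C%C; first by rewrite ltcR.
  by exists y; split => //; move: hy; rewrite nsq_sqn ltcR.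
have [r r0 ->] := epsC e0; have [y [My hy]] := h x r r0.
by exists y; rewrite nsq_sqn ltcR.
Qed.

Lemma cvg_near u x : (forall n, sqn (x - u n) < n.+1%:R^-1) -> cvg_to ip u x.
Proof.
move=> h; apply/cvgP => e /inv_succ_small[N hN]; exists N => n /hN.
by rewrite sqnB; apply: lt_trans.
Qed.

Lemma cvg_cst x : cvg_to ip (fun=> x) x.
Proof. by apply/cvgP => e e0; exists 0%N => n _; rewrite subrr sqn0. Qed.

Lemma cvg_dom u v x : cvg_to ip u x -> (forall n, sqn (v n - x) <= sqn (u n - x)) ->
  cvg_to ip v x.
Proof.
move=> /cvgP h hv; apply/cvgP => e /h[N hN]; exists N => n /hN.
exact: le_lt_trans.
Qed.

Lemma cvgD u v x y : cvg_to ip u x -> cvg_to ip v y ->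
  cvg_to ip (fun n => u n + v n) (x + y).
Proof.
move=> /cvgP hu /cvgP hv; apply/cvgP => e e0; have e4 : 0 < e / 4 by lra.
have [N hN] := hu _ e4; have [N' hN'] := hv _ e4.
exists (maxn N N') => n; rewrite geq_max => /andP[/hN h1 /hN' h2].
rewrite opprD addrACA; have := sqnD_le (u n - x) (v n - y); lra.
Qed.

Lemma cvgN u x : cvg_to ip u x -> cvg_to ip (fun n => - u n) (- x).
Proof.
move=> /cvgP hu; apply/cvgP => e /hu[N hN]; exists N => n /hN.
by rewrite -opprD sqnN.
Qed.

Lemma cvg_uniq u x y : cvg_to ip u x -> cvg_to ip u y -> x = y.
Proof.
move=> hx /cvgN hy; have /cvgP h := cvgD hx hy.
apply/eqP; rewrite -subr_eq0; apply/eqP/sqn_eq0/eq0_small => [|e /h[N hN]].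
  exact: sqn_ge0.
by have := hN N (leqnn N); rewrite subrr add0r sqnN.
Qed.

Lemma cvg_cauchy u x : cvg_to ip u x -> cauchy ip u.
Proof.
move=> /cvgP hu; apply/cauchyP => e e0; have e4 : 0 < e / 4 by lra.
have [N hN] := hu _ e4; exists N => m n /hN h1 /hN h2.
have := sqnDB_le (u m) (u n) x; lra.
Qed.

Lemma cauchy_cvg u : cauchy ip u -> exists x, cvg_to ip u x.
Proof. by case: hU => _ _ _ _; apply. Qed.

Lemma cvg_ipr0 u x y : cvg_to ip u x -> (forall n, ip y (u n) = 0) -> ip y x = 0.
Proof.
move=> /cvgP hu h; apply/sqmod_eq0; rewrite le_eqVlt; apply/orP; left; apply/eqP.
apply/eq0_small => [|e e0]; first exact: sqmod_ge0.
(* The added 1 keeps the divisor positive when [y = 0]. *)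
have y1 : 0 < sqn y + 1 by have := sqn_ge0 y; lra.
have [N /(_ N (leqnn N)) hN] := hu _ (divr_gt0 e0 y1).
have := cauchy_schwarz y (u N - x); rewrite ipBr h sub0r.
have -> : sqmod (- ip y x) = sqmod (ip y x) by rewrite /sqmod normrN.
move=> /le_lt_trans; apply; move: hN; rewrite ltr_pdivlMr //.
have := sqn_ge0 (u N - x); have := sqn_ge0 y; nra.
Qed.

Lemma orth_closed M : closed_set ip (orth ip M).
Proof. by move=> u x hu hc y My; apply: cvg_ipr0 hc _ => n; apply: hu. Qed.

Definition subspace M := M 0 /\ forall a x y, M x -> M y -> M (a *: x + y).

Lemma subspaceZ M a x : subspace M -> M x -> M (a *: x).
Proof. by move=> [M0 h] Mx; rewrite -[_ *: _]addr0; apply: h. Qed.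
Lemma subspaceD M x y : subspace M -> M x -> M y -> M (x + y).
Proof. by move=> [M0 h] Mx My; rewrite -[x]scale1r; apply: h. Qed.
Lemma subspaceN M x : subspace M -> M x -> M (- x).
Proof. by move=> h /subspaceZ; rewrite -scaleN1r; apply. Qed.
Lemma subspaceB M x y : subspace M -> M x -> M y -> M (x - y).
Proof. by move=> h Mx My; apply: subspaceD => //; apply: subspaceN. Qed.

Lemma orth_subspace M : subspace (orth ip M).
Proof.
split=> [y _|a x y hx hy z Mz]; first exact: ip0r.
by rewrite ipDr ipZr hx // hy // mulr0 addr0.
Qed.

Lemma orth_meet M x : M x -> orth ip M x -> x = 0.
Proof. by move=> Mx /(_ x Mx) h; apply: sqn_eq0; rewrite /sqn h. Qed.

(** By Pythagoras, squared distances between terms of the sum are sums of those of the parts, so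
    both parts are Cauchy. This carries closedness through orthogonal sums. *)
Lemma cvg_orth_split u v z : (forall m n, ip (u m) (v n) = 0) ->
  cvg_to ip (fun n => u n + v n) z ->
  exists p q, [/\ cvg_to ip u p, cvg_to ip v q & z = p + q].
Proof.
move=> huv hz; have /cauchyP hc := cvg_cauchy hz.
have hs m n : sqn ((u m + v m) - (u n + v n)) = sqn (u m - u n) + sqn (v m - v n).
  by rewrite opprD addrACA (@pythagoras (u m - u n)) // ipBl !ipBr !huv !subr0.
have [p hp] : exists p, cvg_to ip u p.
  apply/cauchy_cvg/cauchyP => e /hc[N hN]; exists N => m n i j.
  by have := hN m n i j; rewrite hs; have := sqn_ge0 (v m - v n); lra.
have [q hq] : exists q, cvg_to ip v q.
  apply/cauchy_cvg/cauchyP => e /hc[N hN]; exists N => m n i j.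
  by have := hN m n i j; rewrite hs; have := sqn_ge0 (u m - u n); lra.
by exists p, q; split=> //; apply: cvg_uniq hz (cvgD hp hq).
Qed.

(* A minimising sequence is Cauchy by the parallelogram law, and its error terms are
   asymptotically orthogonal to [M] by [ip_gap]. *)
Lemma projection M : subspace M -> closed_set ip M ->
  forall x, exists p q, [/\ M p, orth ip M q & x = p + q].
Proof.
move=> sM cM x; set E : set R := [set r | exists2 m, M m & r = sqn (x - m)]%classic.
have E0 : nonempty E by exists (sqn (x - 0)), 0 => //; case: sM.
have Elb : lbound E 0 by move=> _ [m _ ->]; apply: sqn_ge0.
have hE : has_inf E by split => //; exists 0.
set d := inf E; have dle m : M m -> d <= sqn (x - m).
  by move=> Mm; apply: ge_inf; [exists 0|exists m].
have /choice[u hu] : forall n, exists m, M m /\ sqn (x - m) < d + n.+1%:R^-1.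
  move=> n; have [|_ [m Mm ->] hm] := @inf_adherent _ E n.+1%:R^-1 _ hE.
    by rewrite invr_gt0 ltr0n.
  by exists m.
have Mu n : M (u n) by case: (hu n).
have lu n : sqn (x - u n) < d + n.+1%:R^-1 by case: (hu n).
have [p hp] : exists p, cvg_to ip u p.
  apply/cauchy_cvg/cauchyP => e e0; have e8 : 0 < e / 4 by lra.
  have [N hN] := inv_succ_small e8; exists N => m n /hN i /hN j.
  (* The midpoint of [u m] and [u n] lies in [M], so its squared distance to [x] is at least [d]. *)
  have := parallelogram (x - u m) (x - u n).
  have -> : (x - u m) - (x - u n) = u n - u m by rewrite opprB addrC subrKA.
  have -> : (x - u m) + (x - u n) = 2 *: (x - 2^-1 *: (u m + u n)).
    by rewrite scalerBr scalerA divff ?pnatr_eq0 // scale1r scaler_nat opprD addrACA mulr2n.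
  rewrite sqnZ (_ : sqmod 2 = 4); last first.
    apply: complexI; rewrite sqmodE ger0_norm ?ler0n // -natrX.
    by rewrite rmorphMn.
  have := dle (2^-1 *: (u m + u n)) (subspaceZ _ sM (subspaceD sM (Mu m) (Mu n))).
  have := lu m; have := lu n; rewrite (sqnB (u n)).
  by move: i j; move: (m.+1%:R^-1) (n.+1%:R^-1) => s t; lra.
exists p, (x - p); split; [exact: cM hp| |by rewrite addrC subrK].
move=> m Mm; apply: ip_sym0; apply/sqmod_eq0.
rewrite le_eqVlt; apply/orP; left; apply/eqP/eq0_small => [|e e0]; first exact: sqmod_ge0.
have m1 : 0 < sqn m + 1 by have := sqn_ge0 m; lra.
have e8 : 0 < e / 4 / (sqn m + 1) by apply: divr_gt0 => //; lra.
have [N hN] := inv_succ_small e8; have /cvgP/(_ _ e8)[N' hN'] := hp.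
set n := maxn N N'.
have {}hN := hN n (leq_maxl _ _); have {}hN' := hN' n (leq_maxr _ _).
(* With [x - p = (x - u n) + (u n - p)], [ip_gap] bounds the first product and Cauchy-Schwarz the
   second. *)
have g : sqmod (ip (x - u n) m) <= sqn m * (sqn (x - u n) - d).
  apply: ip_gap => c; rewrite -addrA -opprD; apply/dle/(subspaceD sM) => //.
  exact: subspaceZ.
have c := cauchy_schwarz (u n - p) m.
have := sqmodD_le (ip (x - u n) m) (ip (u n - p) m).
rewrite -ipDl subrKA => /le_lt_trans; apply.
move: hN hN'; set t := _ / _ => hN hN'.
have te : t * (sqn m + 1) = e / 4 by rewrite /t divfK // gt_eqF.
have := lu n; have := sqn_ge0 m; have := dle _ (Mu n).
move: (sqn m) (sqn (x - u n)) (sqn (u n - p)) g c hN hN' te => b q r.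
move: (n.+1%:R^-1) => s g c hN hN' te h1 h2 h3.
have h4 : b * (q - d) <= b * t by apply: ler_wpM2l => //; lra.
have h5 : r * b <= t * b by apply: ler_wpM2r => //; lra.
have : 0 < t by [].
lra.
Qed.

Lemma cvg_closure M x : (forall e : R, 0 < e -> exists y, M y /\ sqn (x - y) < e) ->
  exists u, (forall n, M (u n)) /\ cvg_to ip u x.
Proof.
move=> h; have /choice[u hu] : forall n : nat, exists y, M y /\ sqn (x - y) < n.+1%:R^-1.
  by move=> n; apply: h; rewrite invr_gt0 ltr0n.
exists u; split=> [n|]; first by case: (hu n).
by apply: cvg_near => n; case: (hu n).
Qed.

(** Makes [projection] applicable to a subspace not known to be closed, by passing to its sequential
    closure. *)
Lemma cvg_limit_subspace M : subspace M ->
  let cl x := exists u, (forall n, M (u n)) /\ cvg_to ip u x in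
  [/\ subspace cl, closed_set ip cl & forall x, M x -> cl x].
Proof.
move=> sM cl; have Mcl x : M x -> cl x by exists (fun=> x); split=> //; apply: cvg_cst.
split=> //; first split=> [|a x y [u [Mu hu]] [v [Mv hv]]].
- by apply: Mcl; case: sM.
- exists (fun n => a *: u n + v n); split=> [n|]; first by case: sM => _; apply.
  apply: cvgD hv; apply/cvgP => e e0.
  have a1 : 0 < sqmod a + 1 by have := sqmod_ge0 a; lra.
  have /cvgP/(_ _ (divr_gt0 e0 a1))[N hN] := hu; exists N => n /hN.
  rewrite -scalerBr sqnZ ltr_pdivlMr //.
  have := sqn_ge0 (u n - x); have := sqmod_ge0 a; nra.
- move=> u x clu /cvgP hu; apply: cvg_closure => e e0; have e4 : 0 < e / 4 by lra.
  have [N /(_ N (leqnn N)) hN] := hu _ e4.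
  have [v [Mv /cvgP/(_ _ e4)[N' /(_ N' (leqnn N')) hv]]] := clu N.
  exists (v N'); split=> //; have := sqnDB_le x (v N') (u N); rewrite (sqnB x (u N)); lra.
Qed.

Lemma dense_orth M x : dense ip M -> orth ip M x -> x = 0.
Proof.
move=> /denseP d o; have [|u [Mu hu]] := @cvg_closure M x; first exact: d.
by apply: sqn_eq0; rewrite /sqn (cvg_ipr0 hu) // => n; apply/ip_sym0/o.
Qed.

End HilbertSpace.

(** * Hilbert direct sum of two spaces *)

Section Product.
Variables (R : realType) (H K : lmodType R[i]).
Variables (ipH : H -> H -> R[i]) (ipK : K -> K -> R[i]).
Hypotheses (hH : is_hilbert ipH) (hK : is_hilbert ipK).
Local Notation ipHK := (ip_sum ipH ipK).

Lemma sqn_sum x : sqn ipHK x = sqn ipH x.1 + sqn ipK x.2.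
Proof. by rewrite /sqn /ip_sum raddfD. Qed.

Lemma nsq_sum x : nsq ipHK x = (sqn ipH x.1 + sqn ipK x.2)%:C%C.
Proof. by rewrite rmorphD /= -!nsq_sqn. Qed.

Lemma hilbert_sum : is_hilbert ipHK.
Proof.
have nsq0 x : 0 <= nsq ipHK x by rewrite nsq_sum ler0c addr_ge0 ?sqn_ge0.
split=> [a x y z|x y|x|x h|u hu].
- by rewrite /ip_sum /= (ipDl hH) (ipZl hH) (ipDl hK) (ipZl hK) mulrDr addrACA.
- by rewrite /ip_sum rmorphD /= -(ipC hH) -(ipC hK).
- exact: nsq0.
- have /complexI : (sqn ipH x.1 + sqn ipK x.2)%:C%C = 0%:C%C by rewrite -nsq_sum.
  have := sqn_ge0 hH x.1; have := sqn_ge0 hK x.2 => p q r.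
  rewrite [x]surjective_pairing; congr pair.
    by apply: (sqn_eq0 hH); lra.
  by apply: (sqn_eq0 hK); lra.
have hc e : 0 < e -> exists N, forall m n, (N <= m)%N -> (N <= n)%N ->
    sqn ipH (u m - u n).1 + sqn ipK (u m - u n).2 < e.
  move=> e0; have [|N hN] := hu e%:C%C; first by rewrite ltcR.
  by exists N => m n i j; have := hN m n i j; rewrite nsq_sum ltcR.
have [p hp] : exists p, cvg_to ipH (fun n => (u n).1) p.
  apply/(cauchy_cvg hH)/(cauchyP hH) => e /hc[N hN]; exists N => m n i j.
  by have := hN m n i j; have := sqn_ge0 hK (u m - u n).2 => /=; lra.
have [q hq] : exists q, cvg_to ipK (fun n => (u n).2) q.
  apply/(cauchy_cvg hK)/(cauchyP hK) => e /hc[N hN]; exists N => m n i j.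
  by have := hN m n i j; have := sqn_ge0 hH (u m - u n).1 => /=; lra.
exists (p, q) => e /epsC[r r0 ->]; have r2 : 0 < r / 2 by lra.
have /(cvgP hH)/(_ _ r2)[N hN] := hp; have /(cvgP hK)/(_ _ r2)[N' hN'] := hq.
exists (maxn N N') => n; rewrite geq_max => /andP[/hN h1 /hN' h2].
by rewrite nsq_sum ltcR /=; lra.
Qed.

Lemma cvg_pair u x : cvg_to ipHK u x <->
  cvg_to ipH (fun n => (u n).1) x.1 /\ cvg_to ipK (fun n => (u n).2) x.2.
Proof.
have hHK := hilbert_sum; split=> [/(cvgP hHK) h|[hp hq]].
  split; [apply/(cvgP hH)|apply/(cvgP hK)] => e /h[N hN]; exists N => n /hN;
    rewrite sqn_sum /=.
    by have := sqn_ge0 hK ((u n).2 - x.2); lra.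
  by have := sqn_ge0 hH ((u n).1 - x.1); lra.
apply/(cvgP hHK) => e e0; have e2 : 0 < e / 2 by lra.
have /(cvgP hH)/(_ _ e2)[N hN] := hp; have /(cvgP hK)/(_ _ e2)[N' hN'] := hq.
exists (maxn N N') => n; rewrite geq_max => /andP[/hN h1 /hN' h2].
by rewrite sqn_sum /=; lra.
Qed.

End Product.

(** * Adjoints and Moore-Penrose inverses *)

Section LinearOperator.
Variables (R : realType) (U V : lmodType R[i]) (T : op U V).
Hypothesis linT : linop T.

Lemma dom0 : dom T 0. Proof. by case: linT. Qed.
Lemma domZ a x : dom T x -> dom T (a *: x).
Proof. by case: linT => d0 h dx; rewrite -[_ *: _]addr0; case: (h a x 0 dx d0). Qed.
Lemma domD x y : dom T x -> dom T y -> dom T (x + y).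
Proof. by case: linT => d0 h dx dy; rewrite -[x]scale1r; case: (h 1 x y dx dy). Qed.
Lemma domN x : dom T x -> dom T (- x).
Proof. by rewrite -scaleN1r; apply: domZ. Qed.
Lemma domB x y : dom T x -> dom T y -> dom T (x - y).
Proof. by move=> dx dy; apply/domD/domN. Qed.
Lemma appD x y : dom T x -> dom T y -> app T (x + y) = app T x + app T y.
Proof.
case: linT => d0 h dx dy; rewrite -{1}[x]scale1r.
by case: (h 1 x y dx dy) => _ ->; rewrite scale1r.
Qed.
Lemma app0 : app T 0 = 0.
Proof. by apply: (addrI (app T 0)); rewrite -appD ?addr0 //; apply: dom0. Qed.
Lemma appZ a x : dom T x -> app T (a *: x) = a *: app T x.
Proof.
move=> dx; case: linT => d0 h; rewrite -[a *: x]addr0.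
by case: (h a x 0 dx d0) => _ ->; rewrite app0 addr0.
Qed.
Lemma appN x : dom T x -> app T (- x) = - app T x.
Proof. by move=> dx; rewrite -(scaleN1r x) appZ // scaleN1r. Qed.
Lemma appB x y : dom T x -> dom T y -> app T (x - y) = app T x - app T y.
Proof. by move=> dx dy; rewrite appD ?appN //; apply: domN. Qed.

Lemma range_subspace : subspace (op_range T).
Proof.
split=> [|a _ _ [x [dx <-]] [y [dy <-]]]; first by exists 0; rewrite app0; split => //; apply: dom0.
by exists (a *: x + y); case: linT => _ /(_ a x y dx dy).
Qed.

Lemma kernel_subspace : subspace (kernel T).
Proof.
split=> [|a x y [dx hx] [dy hy]]; first by split; [apply: dom0|apply: app0].
by case: linT => _ /(_ a x y dx dy)[d e]; split=> //; rewrite e hx hy scaler0 addr0.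
Qed.

End LinearOperator.

Section Operator.
Variables (R : realType) (U V : lmodType R[i]).
Variables (ipU : U -> U -> R[i]) (ipV : V -> V -> R[i]).
Hypotheses (hU : is_hilbert ipU) (hV : is_hilbert ipV).
Variable T : op U V.
Hypothesis linT : linop T.
Local Notation Ta := (adjoint ipU ipV T).
Local Notation TaT := (op_mul (adjoint ipU ipV T) T).

Lemma kernel_closed : closed_op ipU ipV T -> closed_set ipU (kernel T).
Proof.
move=> cT u x hu hx; apply: (cT u) => // [n|]; first by case: (hu n).
have -> : (fun n => app T (u n)) = fun=> 0 by apply/funext => n; case: (hu n).
exact: cvg_cst.
Qed.

(** The difference of the images lies in the range and in its orthogonal complement, hence is 0;
    then [x - x'] lies in the kernel and in its complement. *)
Lemma mp_rel_inj y x x' : mp_rel ipU ipV T y x -> mp_rel ipU ipV T y x' -> x = x'.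
Proof.
move=> [[dx cx] [b [hb ->]]] [[dx' cx'] [b' [hb' e]]].
have e' : app T (x - x') = b' - b.
  by rewrite (appB linT) //; apply/eqP; rewrite subr_eq addrAC -subr_eq opprK e addrC.
have z : app T (x - x') = 0.
  apply: (@orth_meet _ _ _ hV (op_range T)).
    by exists (x - x'); split=> //; apply: (domB linT).
  by rewrite e'; apply: (subspaceB (orth_subspace hV _)).
apply/eqP; rewrite -subr_eq0; apply/eqP.
apply: (@orth_meet _ _ _ hU (kernel T)); first by split=> //; apply: (domB linT).
exact: (subspaceB (orth_subspace hU _)).
Qed.

Lemma mp_val y x : mp_rel ipU ipV T y x ->
  dom (mp_inv ipU ipV T) y /\ app (mp_inv ipU ipV T) y = x.
Proof.
move=> h; split; last by apply: xget_unique => // z /mp_rel_inj; apply.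
by case: h => -[dx _] [b [hb e]]; exists (app T x), b; split=> //; exists x.
Qed.

Lemma mp_app y : closed_set ipU (kernel T) -> dom (mp_inv ipU ipV T) y ->
  mp_rel ipU ipV T y (app (mp_inv ipU ipV T) y).
Proof.
move=> ck [_ [b [[x [dx <-]] [hb e]]]]; apply: xgetPex.
(* Subtracting its kernel component moves an arbitrary preimage into the carrier. *)
have [p [q [[dp hp] hq xE]]] := projection hU (kernel_subspace linT) ck x.
have qE : q = x - p by rewrite xE addrC addKr.
exists q; split; first by split=> //; rewrite qE; apply: (domB linT).
by exists b; split=> //; rewrite qE (appB linT) // hp subr0.
Qed.

Lemma mp_total : closed_range ipV T -> forall y, dom (mp_inv ipU ipV T) y.
Proof.
by move=> cr y; have [p [q [hp hq ->]]] := projection hV (range_subspace linT) cr y; exists p, q.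
Qed.

Lemma mp_rel_total : closed_op ipU ipV T -> closed_range ipV T ->
  forall y, mp_rel ipU ipV T y (app (mp_inv ipU ipV T) y).
Proof. by move=> cT cr y; apply/mp_app/mp_total => //; apply: kernel_closed. Qed.

(** Each [y n] is an orthogonal sum of [T (x n)] and a remainder; by [cvg_orth_split] both converge,
    and [T] and orthogonal complements are closed. *)
Lemma mp_rel_closed (y : nat -> V) (x : nat -> U) y0 x0 : closed_op ipU ipV T ->
  (forall n, mp_rel ipU ipV T (y n) (x n)) -> cvg_to ipV y y0 -> cvg_to ipU x x0 ->
  mp_rel ipU ipV T y0 x0.
Proof.
move=> cT h hy hx; have dx n : dom T (x n) by case: (h n) => -[].
have ob n : orth ipV (op_range T) (y n - app T (x n)).
  by case: (h n) => _ [b [hb ->]]; rewrite addrC addKr.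
have [||p [q [hp hq ->]]] := @cvg_orth_split _ _ _ hV
    (fun n => app T (x n)) (fun n => y n - app T (x n)) y0.
- by move=> m n; apply: ob; exists (x m).
- by move: hy; congr cvg_to; apply/funext => n; rewrite addrC subrK.
have [d0 e0] := cT _ _ _ dx hx hp; rewrite -e0.
split; first by split=> //; apply: (orth_closed hU _ hx) => n; case: (h n) => -[].
by exists q; split=> //; apply: (orth_closed hV _ hq).
Qed.

Hypothesis dT : densely_defined ipU T.

Lemma adj_val y z : adj_rel ipU ipV T y z -> dom Ta y /\ app Ta y = z.
Proof.
move=> h; split; first by exists z.
apply: xget_unique => // z' h'; apply/eqP; rewrite -subr_eq0; apply/eqP.
by apply: (dense_orth hU dT) => x dx; rewrite ipBr // -h // -h' // subrr.
Qed.

Lemma adj_app y : dom Ta y -> adj_rel ipU ipV T y (app Ta y).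
Proof. exact: xgetPex. Qed.

Lemma adj_lin : linop Ta.
Proof.
split=> [|a x y dx dy].
  by apply: (proj1 (@adj_val 0 0 _)) => x dx; rewrite !ip0r.
apply: adj_val => z dz; rewrite !ipDr // !ipZr //.
by rewrite (adj_app dx dz) (adj_app dy dz).
Qed.

Lemma orth_range_adj y : orth ipV (op_range T) y -> dom Ta y /\ app Ta y = 0.
Proof. by move=> h; apply: adj_val => x dx; rewrite ip0r // h //; exists x. Qed.

Lemma adj_relD y y' z z' :
  adj_rel ipU ipV T y z -> adj_rel ipU ipV T y' z' -> adj_rel ipU ipV T (y + y') (z + z').
Proof. by move=> h h' x dx; rewrite (ipDr hU) (ipDr hV) h // h'. Qed.

Lemma adj_relN y z :
  adj_rel ipU ipV T y z -> adj_rel ipU ipV T (- y) (- z).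
Proof. by move=> h x dx; rewrite (ipNr hU) (ipNr hV) h. Qed.

Lemma kernel_orth_adj x y : kernel T x -> dom Ta y -> ipU x (app Ta y) = 0.
Proof. by move=> [dx hx] dy; rewrite -(adj_app dy dx) hx ip0l. Qed.

(** The squared norm of [T x] is the inner product of [x] with [T^* T x]. *)
Lemma adjmul_orth x : dom TaT x -> app TaT x = 0 -> app T x = 0.
Proof.
by move=> [dx dTx] h; apply: (sqn_eq0 hV); rewrite /sqn (adj_app dTx dx) /= in h *; rewrite h ip0r.
Qed.

Lemma adjmul_lin : linop TaT.
Proof.
have la := adj_lin; split.
  by split; [apply: (dom0 linT)|rewrite (app0 linT); case: la].
move=> a x y [dx hx] [dy hy]; case: linT => _ /(_ a x y dx dy)[d e].
by case: la => _ /(_ a _ _ hx hy)[d' e']; split; [split|]; rewrite /= ?e.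
Qed.

Lemma kernel_adjmul x : kernel TaT x <-> kernel T x.
Proof.
split=> [[d h]|[d h]]; first by split; [case: d|apply: adjmul_orth].
have [la0 _] := adj_lin.
have a0 : app Ta 0 = 0 by apply: (proj2 (orth_range_adj _)) => z _; rewrite ip0r.
by split; [split|]; rewrite //= h.
Qed.

Hypothesis cT : closed_op ipU ipV T.

(* Orthogonal projection of [(h, k)] onto the graph of [T], whose orthogonal complement
   is [{(- T^* w, w)}]. *)
Lemma graph_split h k : exists u w,
  [/\ dom T u, dom Ta w, h = u - app Ta w & k = app T u + w].
Proof.
have hUV := hilbert_sum hU hV.
pose G (p : U * V) := dom T p.1 /\ p.2 = app T p.1.
have sG : subspace G.
  split=> [|a [x _] [y _] [/= dx ->] [/= dy ->]].
    by split=> /=; [apply: (dom0 linT)|rewrite (app0 linT)].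
  by case: linT => _ /(_ a x y dx dy)[d e]; split.
have cG : closed_set (ip_sum ipU ipV) G.
  move=> p q Gp /(cvg_pair hU hV)[h1 h2].
  have [||d e] := cT _ h1 (y := q.2); [by move=> n; case: (Gp n)| |by split].
  by move: h2; congr cvg_to; apply/funext => n; case: (Gp n).
have [[u _] [[v w] [[/= du ->] o [-> ->]]]] := projection hUV sG cG (h, k).
(* Orthogonality of [(v, w)] to every [(x, T x)] says that [T^* w = - v]. *)
have [|dw e] := @adj_val w (- v).
  move=> x dx; have := o (x, app T x) (conj dx erefl); rewrite /ip_sum /= => e.
  by apply/eqP; rewrite ipNr // -addr_eq0 addrC; apply/eqP.
by exists u, w; have -> : v = - app Ta w by rewrite e opprK.
Qed.

(** Write [x = u - T^* w] with [T u = - w]. The product of [x] with [T^* w] is then minus the sum of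
    the squared norms of [w] and [T^* w]; as it is 0, [w = 0] and [x = u] lies in the kernel. *)
Lemma orth_range_kernel x : (forall y, dom Ta y -> ipU x (app Ta y) = 0) -> kernel T x.
Proof.
move=> o; have [u [w [du dw xE uw]]] := graph_split x 0.
have wE : app T u = - w by apply/eqP; rewrite -addr_eq0 -uw.
have : ipU (u - app Ta w) (app Ta w) = 0 by rewrite -xE o.
rewrite ipBl // -(adj_app dw du) wE ipNl // => /eqP.
rewrite -opprD oppr_eq0 => /eqP h.
have [w0 a0] : w = 0 /\ app Ta w = 0.
  have /(sqn_eq0 (hilbert_sum hV hU)) : sqn (ip_sum ipV ipU) (w, app Ta w) = 0.
    by rewrite /sqn /ip_sum h.
  by case.
by move: xE; rewrite a0 subr0 => ->; split=> //; rewrite wE w0 oppr0.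
Qed.

(* [D(T^* T)] is a core: a vector of the graph orthogonal to the graph of the restriction
   has first component orthogonal to the range of [1 + T^* T], which is everything. *)
Lemma adjmul_core z : dom T z -> exists u,
  [/\ forall n, dom TaT (u n), cvg_to ipU u z & cvg_to ipV (fun n => app T (u n)) (app T z)].
Proof.
move=> dz; have hUV := hilbert_sum hU hV.
pose G (p : U * V) := dom TaT p.1 /\ p.2 = app T p.1.
have lTT := adjmul_lin.
have sG : subspace G.
  split=> [|a [x _] [y _] [/= dx ->] [/= dy ->]].
    by split=> /=; [case: lTT|rewrite (app0 linT)].
  split=> /=; first by case: lTT => _ /(_ a x y dx dy)[].
  by case: dx dy => dx _ [dy _]; case: linT => _ /(_ a x y dx dy)[_ ->].
have [sC cC GC] := cvg_limit_subspace hUV sG.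
have [p [q [[g [Gg hg]] oq e]]] := projection hUV sC cC (z, app T z).
have gE n : app T (g n).1 = (g n).2 by case: (Gg n).
have [hg1 hg2] := (cvg_pair hU hV g p).1 hg.
have hg2' : cvg_to ipV (fun n => app T (g n).1) p.2.
  by move: hg2; congr cvg_to; apply/funext.
have [|dp pE] := cT _ hg1 hg2'; first by move=> n; case: (Gg n) => -[].
have [z1 z2] : z = p.1 + q.1 /\ app T z = p.2 + q.2.
  by rewrite (surjective_pairing p) (surjective_pairing q) in e *; case: e.
have q1E : q.1 = z - p.1 by rewrite z1 addrC addKr.
have dq : dom T q.1 by rewrite q1E; apply: (domB linT).
have qE : q.2 = app T q.1 by rewrite q1E (appB linT) // pE z2 addrC addKr.
(* Solves [q.1 = u + T^* T u]; orthogonality of [q] to [(u, T u)] then makes [q.1] orthogonal to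
   itself. *)
have [u [w [du dw uE uw]]] := graph_split q.1 0.
have wE : w = app T (- u) by rewrite (appN linT) //; apply/eqP; rewrite -addr_eq0 addrC -uw.
have dTu : dom TaT u.
  split=> //; rewrite -[u]opprK (appN linT); last exact: (domN linT).
  by rewrite -wE; exact: (domN adj_lin dw).
have q10 : q.1 = 0.
  have [_ dTu'] := dTu.
  have := oq (u, app T u) (GC (u, app T u) (conj dTu erefl)).
  rewrite /ip_sum /= qE => h; apply: (sqn_eq0 hU); rewrite /sqn.
  have -> : ipU q.1 q.1 = 0 => //; rewrite {2}uE wE (appN linT) // (appN adj_lin dTu') opprK.
  rewrite ipDr // -(adj_app dTu' dq).
  by rewrite (ipC hU u) (ipC hV (app T u)) -rmorphD h rmorph0.
have q20 : q.2 = 0 by rewrite qE q10 (app0 linT).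
exists (fun n => (g n).1); split=> [n||]; first by case: (Gg n).
  by rewrite z1 q10 addr0.
by rewrite z2 q20 addr0.
Qed.

(** [T x] is the projection of [y] onto the closed range, and [T^*] kills the rest; so [T^* T] and
    [T^*] have the same range. *)
Lemma range_adjmul y : closed_range ipV T -> dom Ta y -> exists x,
  [/\ dom TaT x, app TaT x = app Ta y & orth ipV (op_range T) (y - app T x)].
Proof.
move=> cr dy; have [_ [b [[x [dx <-]] ob yE]]] := projection hV (range_subspace linT) cr y.
have bE : b = y - app T x by rewrite yE addrC addKr.
have [db b0] := orth_range_adj ob.
have e : app T x = y - b by rewrite yE addrK.
exists x; rewrite -bE; split=> //; first by split=> //; rewrite e; exact: (domB adj_lin dy db).
by change (app Ta (app T x) = app Ta y); rewrite e (appB adj_lin dy db) b0 subr0.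
Qed.

End Operator.

(** * Operators whose adjoints have complementary ranges *)

Section OrthogonalPair.
Variables (R : realType).

(** A Leibniz equality rather than [op_eq], so that it rewrites under [mp_inv] and [op_closure]. *)
Lemma op_addC (X Y : lmodType R[i]) (P Q : op X Y) : op_add P Q = op_add Q P.
Proof.
rewrite /op_add; congr Op; apply/funext => x; last exact: addrC.
by apply/propext; split=> -[].
Qed.

(** The hypotheses on [T1] and [T3], with a different target space allowed for each operator:
    through [orth_pair_sym], each result for [A] also serves for [B]. *)
Record orth_pair (H U V : lmodType R[i]) (ipH : H -> H -> R[i])
  (ipU : U -> U -> R[i]) (ipV : V -> V -> R[i]) (A : op H U) (B : op H V) : Prop :=
  OrthPair {
    pairH : is_hilbert ipH; pairU : is_hilbert ipU; pairV : is_hilbert ipV;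
    pair_linA : linop A; pair_linB : linop B;
    pair_denseA : densely_defined ipH A; pair_denseB : densely_defined ipH B;
    pair_closedA : closed_op ipH ipU A; pair_closedB : closed_op ipH ipV B;
    pair_rangeA : closed_range ipU A; pair_rangeB : closed_range ipV B;
    pair_dsum : orth_dsum_full ipH (op_range (adjoint ipH ipU A)) (op_range (adjoint ipH ipV B)) }.

Lemma orth_pair_sym (H U V : lmodType R[i]) (ipH : H -> H -> R[i])
  (ipU : U -> U -> R[i]) (ipV : V -> V -> R[i]) (A : op H U) (B : op H V) :
  orth_pair ipH ipU ipV A B -> orth_pair ipH ipV ipU B A.
Proof.
case=> hH hU hV lA lB dA dB cA cB rA rB [p f]; split=> //.
split=> [x y hx hy|x]; first by apply/(ip_sym0 hH)/p.
by have [a [b [ha [hb ->]]]] := f x; exists b, a; rewrite addrC.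
Qed.

Variables (H U V : lmodType R[i]).
Variables (ipH : H -> H -> R[i]) (ipU : U -> U -> R[i]) (ipV : V -> V -> R[i]).
Variables (A : op H U) (B : op H V).
Hypothesis hp : orth_pair ipH ipU ipV A B.
Local Notation Aa := (adjoint ipH ipU A).
Local Notation Ba := (adjoint ipH ipV B).
Local Notation AaA := (op_mul Aa A).
Local Notation BaB := (op_mul Ba B).

Let hH := pairH hp.
Let hU := pairU hp.
Let hV := pairV hp.
Let lA := pair_linA hp.
Let lB := pair_linB hp.
Let dA := pair_denseA hp.
Let dB := pair_denseB hp.
Let cA := pair_closedA hp.
Let cB := pair_closedB hp.
Let rA := pair_rangeA hp.

Lemma adj_adj_orth y z : dom Aa y -> dom Ba z -> ipH (app Aa y) (app Ba z) = 0.
Proof. by case: (pair_dsum hp) => p _ dy dz; apply: p; [exists y|exists z]. Qed.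

Lemma kernel_adj_right z : dom Ba z -> kernel A (app Ba z).
Proof.
move=> dz; apply: (orth_range_kernel hH hU lA dA cA) => y dy.
exact/(ip_sym0 hH)/adj_adj_orth.
Qed.

(** The component [A^* y] of [x] is orthogonal to [x], which is in the kernel of [A], and to
    [B^* z]; hence it is orthogonal to itself. *)
Lemma kernel_range_right x : kernel A x -> op_range Ba x.
Proof.
move=> kx; have [_ /(_ x)[_ [_ [[y [dy <-]] [[z [dz <-]] xE]]]]] := pair_dsum hp.
exists z; split=> //; rewrite xE (_ : app Aa y = 0) ?add0r //.
have := kernel_orth_adj hU kx dy; rewrite xE ipDl //.
rewrite (ip_sym0 hH (adj_adj_orth dy dz)) addr0 => h.
by apply: (sqn_eq0 hH); rewrite /sqn h.
Qed.

Lemma kernel_carrier x : kernel B x -> orth ipH (kernel A) x.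
Proof.
move=> kx _ /kernel_range_right[z [dz <-]].
exact/(ip_sym0 hH)/(kernel_orth_adj hV).
Qed.

Lemma kernel_meet x : kernel A x -> kernel B x -> x = 0.
Proof. by move=> kA /kernel_carrier; apply: orth_meet. Qed.

(** In [x = A^* y + B^* z] the second term lies in the kernel of [A], so the first stays in the
    domain of [A]; it is moreover in the kernel, hence the domain, of [B]. This makes the common
    domain large enough. *)
Lemma left_part x : dom A x -> exists x',
  [/\ dom A x', app A x' = app A x, kernel B x' & kernel A (x - x')].
Proof.
move=> dx; have [_ /(_ x)[_ [_ [[y [dy <-]] [[z [dz <-]] xE]]]]] := pair_dsum hp.
have [dk k0] := kernel_adj_right dz.
have yE : app Aa y = x - app Ba z by rewrite xE addrK.
exists (app Aa y); split.
- by rewrite yE; apply: domB.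
- by rewrite yE appB // k0 subr0.
- apply: (orth_range_kernel hH hV lB dB cB) => w dw; exact: adj_adj_orth.
- by rewrite xE addrC addKr.
Qed.

Lemma carrier_kernel x : orth ipH (kernel A) x -> kernel B x.
Proof.
move=> o; apply: (orth_range_kernel hH hV lB dB cB) => w dw.
by apply: (ip_sym0 hH); apply: o; apply: kernel_adj_right.
Qed.

Lemma adj_preimage y : dom Aa y -> exists x,
  [/\ dom AaA x, app AaA x = app Aa y, kernel B x & orth ipU (op_range A) (y - app A x)].
Proof.
move=> dy; have [x [[dx dAx] e o]] := range_adjmul hH hU lA dA rA dy.
have [x' [dx' e' kx' _]] := left_part dx.
exists x'; rewrite e'; split=> //; first by split; rewrite ?e'.
by change (app Aa (app A x') = app Aa y); rewrite e'.
Qed.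

(** Any [x] in the domain of [A] may be replaced by its left part, which lies in both domains and on
    which [B] vanishes; so testing on the common domain determines the adjoint of [A]. *)
Lemma pair_adj u v z :
  (forall x, dom A x -> dom B x -> ipU (app A x) u + ipV (app B x) v = ipH x z) ->
  exists a b, [/\ adj_rel ipH ipU A u a, op_range Aa a, op_range Ba b & z = a + b].
Proof.
move=> h; have [_ /(_ z)[_ [_ [[y [dy <-]] [[w [dw <-]] zE]]]]] := pair_dsum hp.
exists (app Aa y), (app Ba w); split; [|by exists y|by exists w|by []].
move=> x dx; have [x' [dx' <- kx' ko]] := left_part dx.
have [dBx' Bx'] := kx'.
have := h x' dx' dBx'; rewrite Bx' ip0l // addr0 zE ipDr // => ->.
rewrite (kernel_orth_adj hV kx' dw) addr0.
apply/esym/eqP; rewrite -subr_eq0 -ipBl //.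
by rewrite (kernel_orth_adj hU ko dy).
Qed.

Local Notation S := (op_add AaA BaB).

Lemma sum_lin : linop S.
Proof.
have [a0 a1] := adjmul_lin hH hU lA dA; have [b0 b1] := adjmul_lin hH hV lB dB.
split=> [//|a x y [dx dx'] [dy dy']].
have [d e] := a1 a x y dx dy; have [d' e'] := b1 a x y dx' dy'.
split; first by split.
by change (app AaA (a *: x + y) + app BaB (a *: x + y) =
   a *: (app AaA x + app BaB x) + (app AaA y + app BaB y));
  rewrite e e' scalerDr addrACA.
Qed.

Lemma sum_orth_eq0 y z : dom Aa y -> dom Ba z -> app Aa y + app Ba z = 0 ->
  app Aa y = 0 /\ app Ba z = 0.
Proof.
move=> dy dz /eqP; rewrite addr_eq0 => /eqP e.
have y0 : app Aa y = 0.
  by apply: (sqn_eq0 hH); rewrite /sqn {2}e ipNr // adj_adj_orth // oppr0.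
by split=> //; apply/eqP; rewrite -oppr_eq0 -e y0.
Qed.

(** [A^* A x] and [B^* B x] are orthogonal with sum 0, so both vanish and [x] lies in both
    kernels. *)
Lemma sum_kernel x : kernel S x -> x = 0.
Proof.
move=> [[dx dx'] h]; have [d1 d2] := dx; have [d3 d4] := dx'.
have [e1 e2] := sum_orth_eq0 d2 d4 h.
apply: kernel_meet; split=> //; first exact: (adjmul_orth hH hU dx e1).
exact: (adjmul_orth hH hV dx' e2).
Qed.

Lemma domS_left x1 x2 : dom AaA x1 -> kernel A x2 -> dom AaA (x1 + x2) /\
  app AaA (x1 + x2) = app AaA x1.
Proof.
move=> [d1 d1'] [d2 e2]; have e : app A (x1 + x2) = app A x1 by rewrite appD // e2 addr0.
split; first by split; [apply: domD|rewrite e].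
by change (app Aa (app A (x1 + x2)) = app Aa (app A x1)); rewrite e.
Qed.

End OrthogonalPair.

(** * Moore-Penrose inverse of [S] and the closure of [S^dagger A^*] *)

Section SumOfSquares.
Variables (R : realType) (H U V : lmodType R[i]).
Variables (ipH : H -> H -> R[i]) (ipU : U -> U -> R[i]) (ipV : V -> V -> R[i]).
Variables (A : op H U) (B : op H V).
Hypothesis hp : orth_pair ipH ipU ipV A B.
Local Notation Aa := (adjoint ipH ipU A).
Local Notation Ba := (adjoint ipH ipV B).
Local Notation AaA := (op_mul Aa A).
Local Notation BaB := (op_mul Ba B).
Local Notation S := (op_add AaA BaB).

Let hH := pairH hp.
Let hU := pairU hp.
Let hV := pairV hp.
Let lA := pair_linA hp.
Let lB := pair_linB hp.
Let dA := pair_denseA hp.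
Let dB := pair_denseB hp.
Let cA := pair_closedA hp.
Let rA := pair_rangeA hp.
Let hp' := orth_pair_sym hp.

(** [S] is injective, so its carrier is its whole domain; each summand of [S] sees only one of [x1],
    [x2], and no remainder is left. *)
Lemma sum_mp x1 x2 : dom AaA x1 -> kernel B x1 -> dom BaB x2 -> kernel A x2 ->
  mp_rel ipH ipH S (app AaA x1 + app BaB x2) (x1 + x2).
Proof.
move=> d1 k1 d2 k2; have [dA' eA] := domS_left hp d1 k2.
have [dB' eB] := domS_left hp' d2 k1; rewrite addrC in dB' eB.
split; first by split=> // z /(sum_kernel hp) ->; rewrite ip0l.
exists 0; split=> [z _|]; first by rewrite ip0r.
by change (app AaA x1 + app BaB x2 =
   app AaA (x1 + x2) + app BaB (x1 + x2) + 0); rewrite eA eB addr0.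
Qed.

Lemma sum_surj h : exists x1 x2, [/\ dom AaA x1 /\ kernel B x1, dom BaB x2 /\ kernel A x2 &
  h = app AaA x1 + app BaB x2].
Proof.
have [_ /(_ h)[_ [_ [[y [dy <-]] [[z [dz <-]] ->]]]]] := pair_dsum hp.
have [x1 [d1 <- k1 _]] := adj_preimage hp dy.
have [x2 [d2 <- k2 _]] := adj_preimage hp' dz.
by exists x1, x2.
Qed.

(** The term [B^* B x2] is the remainder orthogonal to the range of [A^* A]. *)
Lemma adjmul_mp x1 x2 : dom AaA x1 -> kernel B x1 -> dom BaB x2 ->
  mp_rel ipH ipH AaA (app AaA x1 + app BaB x2) x1.
Proof.
move=> d1 k1 [_ d2]; split.
  split=> // z /(kernel_adjmul hH hU dA); apply: (kernel_carrier hp k1).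
exists (app BaB x2); split=> // _ [w [[_ dw] <-]].
exact: (adj_adj_orth hp dw d2).
Qed.

Local Notation SA := (op_mul (mp_inv ipH ipH S) Aa).

(** The solution of [S x = A^* y] given by [adj_preimage] lies in the carrier of [A] and leaves
    [y - A x] orthogonal to the range: [S^dagger A^*] restricts [A^dagger]. *)
Lemma sum_mp_adj y : dom Aa y -> dom SA y /\ mp_rel ipH ipU A y (app SA y).
Proof.
move=> dy; have [x [dx e k o]] := adj_preimage hp dy.
have d0 : dom BaB 0 by case: (adjmul_lin hH hV lB dB).
have k0 : kernel A 0 by case: (kernel_subspace lA).
have := sum_mp dx k d0 k0.
rewrite (app0 (adjmul_lin hH hV lB dB)) !addr0 e => /(mp_val hH hH (sum_lin hp))[ds es].
split=> //; change (mp_rel ipH ipU A y (app (mp_inv ipH ipH S) (app Aa y))); rewrite es.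
split; first by split; [case: dx|apply: (kernel_carrier hp k)].
by exists (y - app A x); split=> //; rewrite addrC subrK.
Qed.

Lemma sum_mp_closure y x : closure_graph ipU ipH SA y x <-> mp_rel ipH ipU A y x.
Proof.
split=> [[u [du [hu hx]]]|[[dx cx] [b [ob ->]]]].
  apply: (mp_rel_closed hH hU cA) hu hx => n.
  by case: (du n) => /sum_mp_adj[].
(* The core approximates [x] in graph norm; adding [b], which [A^*] kills, gives points [y' n] in
   the domain of [A^*] tending to [A x + b]. *)
have [u [du hu hAu]] := adjmul_core hH hU lA dA cA dx.
pose y' n := app A (u n) + b.
have dy' n : dom Aa (y' n).
  apply: (domD (adj_lin hH hU dA)); first by case: (du n).
  by case: (orth_range_adj hH dA ob).
exists y'; split=> [n|]; first by case: (sum_mp_adj (dy' n)).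
split; first exact: (cvgD hU hAu (cvg_cst hU b)).
apply: (cvg_dom hH hu) => n; have [_] := sum_mp_adj (dy' n).
set x' := app SA (y' n) => -[[dx' cx'] [b' [ob' e]]].
have [dun _] := du n.
have du' : dom A (u n - x') by apply: domB.
have k : kernel A (u n - x').
  split=> //; apply: (orth_meet hU (M := op_range A)); first by exists (u n - x').
  have -> : app A (u n - x') = b' - b.
    rewrite appB //; apply/eqP; rewrite subr_eq addrAC -subr_eq opprK.
    by rewrite -[X in X == _]/(y' n) e addrC.
  exact: (subspaceB (orth_subspace hU _)).
(* [x'] is the part of [u n] orthogonal to the kernel of [A], and [x] is orthogonal to it too, so
   [x'] is at least as near to [x] as [u n] is. *)
have o : ipH (u n - x') (x' - x) = 0 by apply: (subspaceB (orth_subspace hH _) cx' cx).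
have -> : u n - x = (u n - x') + (x' - x) by rewrite subrKA.
by rewrite (pythagoras hH o) lerDr sqn_ge0.
Qed.

Lemma sum_mp_closable : closable ipU ipH SA.
Proof.
move=> u y du hu hy; apply: (mp_rel_inj hH hU lA (y := 0)).
  by apply/sum_mp_closure; exists u.
split; first by split; [case: lA|move=> z _; rewrite ip0r].
by exists 0; split=> [z _|]; rewrite ?ip0r // app0 // addr0.
Qed.

Lemma sum_mp_closureE : op_eq (mp_inv ipH ipU A) (op_closure ipU ipH SA).
Proof.
have m := mp_rel_total hH hU lA cA rA.
split=> x; first split=> _; last move=> _.
- by exists (app (mp_inv ipH ipU A) x); apply/sum_mp_closure.
- exact: mp_total.
apply/esym/xget_unique; first exact/sum_mp_closure.
by move=> y /sum_mp_closure h; apply: (mp_rel_inj hH hU lA h).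
Qed.

End SumOfSquares.

(** * The block operator *)

Lemma blk_op_eq (R : realType) (U1 U2 V1 V2 : lmodType R[i])
  (A A' : op U1 V1) (B B' : op U2 V1) (C : op U1 V2) (D : op U2 V2) :
  op_eq A A' -> op_eq B B' -> op_eq (blk A B C D) (blk A' B' C D).
Proof.
move=> [dA eA] [dB eB]; split=> x; first by split=> -[/dA ? /dB ? ? ?].
by move=> [/= hA hB _ _]; rewrite /= eA // eB.
Qed.

Section BlockOperator.
Variables (R : realType) (H K : lmodType R[i]).
Variables (ipH : H -> H -> R[i]) (ipK : K -> K -> R[i]).
Variables (T1 : op H H) (T3 : op H K) (T4 : op K K).
Hypothesis hp : orth_pair ipH ipH ipK T1 T3.
Hypotheses (l4 : linop T4) (d4 : densely_defined ipK T4).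
Hypotheses (c4 : closed_op ipK ipK T4) (r4 : closed_range ipK T4).
Hypothesis p34 : perp ipK (op_range T3) (op_range T4).
Local Notation T1a := (adjoint ipH ipH T1).
Local Notation T3a := (adjoint ipH ipK T3).
Local Notation T4a := (adjoint ipK ipK T4).
Local Notation S1 := (op_mul T1a T1).
Local Notation S3 := (op_mul T3a T3).
Local Notation S4 := (op_mul T4a T4).
Local Notation S := (op_add S1 S3).
Local Notation ipHK := (ip_sum ipH ipK).
Local Notation T := (blk T1 (zero_op K H) T3 T4).
Local Notation Ta := (adjoint ipHK ipHK T).
Local Notation TaT := (op_mul Ta T).
Hypothesis dS : dense ipH (dom S).

Let hH := pairH hp.
Let hK := pairV hp.
Let l1 := pair_linA hp.
Let l3 := pair_linB hp.
Let d1 := pair_denseA hp.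
Let d3 := pair_denseB hp.
Let c1 := pair_closedA hp.
Let c3 := pair_closedB hp.
Let r1 := pair_rangeA hp.
Let r3 := pair_rangeB hp.
Let hp' := orth_pair_sym hp.
Let hHK := hilbert_sum hH hK.

Lemma blk_dom x y : dom T1 x -> dom T3 x -> dom T4 y -> dom T (x, y).
Proof. by split. Qed.

Lemma blk_app x y : app T (x, y) = (app T1 x, app T3 x + app T4 y).
Proof. by rewrite /= addr0. Qed.

Lemma blk_lin : linop T.
Proof.
split=> [|a [x x'] [y y'] [/= h1 _ h3 h4] [/= k1 _ k3 k4]].
  by split=> //; [case: l1|case: l3|case: l4].
case: l1 => _ /(_ a x y h1 k1)[d1' e1]; case: l3 => _ /(_ a x y h3 k3)[d3' e3].
case: l4 => _ /(_ a x' y' h4 k4)[d4' e4]; split; first by split.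
change (app T (a *: x + y, a *: x' + y') = a *: app T (x, x') + app T (y, y')).
by rewrite !blk_app e1 e3 e4 addrACA -scalerDr.
Qed.

(** The domain contains the product of the dense sets [dom S] and [dom T4]. *)
Lemma blk_dense : densely_defined ipHK T.
Proof.
apply/(denseP hHK) => -[x y] e e0; have e2 : 0 < e / 2 by lra.
have /(denseP hH)/(_ x _ e2)[x' [[[dx _] [dx' _]] hx]] := dS.
have /(denseP hK)/(_ y _ e2)[y' [dy hy]] := d4.
exists (x', y'); split; first exact: blk_dom.
by rewrite sqn_sum /=; lra.
Qed.

Lemma blk_closed : closed_op ipHK ipHK T.
Proof.
move=> u [x x'] [y y'] du /(cvg_pair hH hK)[/= hu hu'] /(cvg_pair hH hK)[/= hy hy'].
have du1 n : dom T1 (u n).1 by case: (du n).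
have du3 n : dom T3 (u n).1 by case: (du n).
have du4 n : dom T4 (u n).2 by case: (du n).
have hy1 : cvg_to ipH (fun n => app T1 (u n).1) y.
  by move: hy; congr cvg_to; apply/funext => n; rewrite addr0.
have [dx e1] := c1 du1 hu hy1.
(* Orthogonality of the ranges makes the [T3] and [T4] parts converge separately. *)
have [|p [q [hp3 hq4 yE]]] := cvg_orth_split hK _ hy'.
  by move=> m n; apply: p34; [exists (u m).1|exists (u n).2].
have [dx3 e3] := c3 du3 hu hp3; have [dx4 e4] := c4 du4 hu' hq4.
split; first exact: blk_dom.
by change (app T (x, x') = (y, y')); rewrite blk_app e1 e3 e4 yE.
Qed.

Lemma blk_range_closed : closed_range ipHK T.
Proof.
move=> u [y y'] ru /(cvg_pair hH hK)[/= hy hy'].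
have /choice[w hw] := ru.
have w1 n : dom T1 (w n).1 /\ app T1 (w n).1 = (u n).1.
  by have [[h _ _ _] <-] := hw n; rewrite /= addr0.
have w2 n : [/\ dom T3 (w n).1, dom T4 (w n).2 & app T3 (w n).1 + app T4 (w n).2 = (u n).2].
  by have [[_ _ h h'] <-] := hw n.
have [x [dx xy]] : op_range T1 y by apply: (r1 _ hy) => n; exists (w n).1.
have [||p [q [hp3 hq4 yE]]] := @cvg_orth_split _ _ _ hK
    (fun n => app T3 (w n).1) (fun n => app T4 (w n).2) y'.
- by move=> m n; case: (w2 m) (w2 n) => a _ _ [_ b _]; apply: p34; [exists (w m).1|exists (w n).2].
- by move: hy'; congr cvg_to; apply/funext => n; case: (w2 n).
have [z [dz zp]] : op_range T3 p by apply: (r3 _ hp3) => n; exists (w n).1; case: (w2 n).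
have [v [dv vq]] : op_range T4 q by apply: (r4 _ hq4) => n; exists (w n).2; case: (w2 n).
(* The preimages [x] and [z] are unrelated; their parts killed by [T3] and by [T1] respectively add
   up to one vector serving both rows. *)
have [x' [dx' ex [dx3 ex3] _]] := left_part hp dx.
have [z' [dz' ez [dz1 ez1] _]] := left_part hp' dz.
exists (x' + z', v); split.
  by apply: blk_dom => //; [apply: (domD l1)|apply: (domD l3)].
change (app T (x' + z', v) = (y, y')).
by rewrite blk_app (appD l1) // (appD l3) // ez1 ex3 ex ez xy zp vq addr0 add0r yE.
Qed.

Lemma blk_kernel x : kernel T x -> [/\ kernel T1 x.1, kernel T3 x.1 & kernel T4 x.2].
Proof.
case: x => x y [[h1 _ h3 h4]]; rewrite blk_app => -[e1 e2]; rewrite /= in h1 h3 h4 *.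
have e3 : app T3 x = 0.
  apply: (sqn_eq0 hK); rewrite /sqn.
  have {2}-> : app T3 x = - app T4 y by apply/eqP; rewrite -addr_eq0 e2.
  by rewrite (ipNr hK) p34 ?oppr0 //; [exists x|exists y].
by split; split=> //; rewrite -e2 e3 add0r.
Qed.

Lemma orth_parts h k (y : H * K) : orth ipH (op_range T1) y.1 ->
  orth ipK (op_range T3) y.2 -> orth ipK (op_range T4) y.2 ->
  h = y.1 -> k = y.2 -> orth ipHK (op_range T) (h, k).
Proof.
move=> o1 o3 o4 -> -> _ [[u v] [[du _ du3 dv] <-]]; rewrite blk_app.
rewrite /ip_sum /= in du du3 dv *.
rewrite (ipDl hK) o1; last by exists u.
by rewrite o3 ?o4 ?addr0 //; [exists v|exists u].
Qed.

(** The carrier of [T1] lies in the kernel of [T3] and conversely, so [T] maps [(x1 + x3, x4)] to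
    [(T1 x1, T3 x3 + T4 x4)]. *)
Lemma blk_mp h k x1 x3 x4 : mp_rel ipH ipH T1 h x1 -> mp_rel ipH ipK T3 k x3 ->
  mp_rel ipK ipK T4 k x4 -> mp_rel ipHK ipHK T (h, k) (x1 + x3, x4).
Proof.
move=> [[dx1 cx1] [b1 [o1 e1]]] [[dx3 cx3] [b3 [o3 e3]]] [[dx4 cx4] [b4 [o4 e4]]].
have kb3 : k - app T3 x3 = b3 by rewrite e3 addrC addKr.
have kb4 : k - app T4 x4 = b4 by rewrite e4 addrC addKr.
have [dx13 e13] := carrier_kernel hp cx1; have [dx31 e31] := carrier_kernel hp' cx3.
split.
  split; first by apply: blk_dom => //; [apply: (domD l1)|apply: (domD l3)].
  move=> z /blk_kernel[k1 k3 k4]; rewrite /ip_sum /= (ipDr hH).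
  by rewrite (cx1 _ k1) (cx3 _ k3) (cx4 _ k4) !addr0.
(* Removing from [k] its components in two mutually orthogonal ranges leaves a vector orthogonal to
   both. *)
exists (b1, k - app T3 x3 - app T4 x4); split.
  apply: (orth_parts (y := (b1, k - app T3 x3 - app T4 x4))) => //= _ [z [dz <-]].
    by rewrite kb3 (ipBr hK) o3 ?p34 ?subr0 //; [exists z|exists x4|exists z].
  rewrite addrAC kb4 (ipBr hK) o4; last by exists z.
  by rewrite (ip_sym0 hK (p34 _ _)) ?subr0 //; [exists x3|exists z].
rewrite blk_app (appD l1) // (appD l3) // e13 e31 addr0 add0r {1}e1.
by congr pair; rewrite /= -[k - _ - _]addrA -opprD [RHS]addrC subrK.
Qed.

Lemma blk_adj_rel u v a b c : adj_rel ipH ipH T1 u a -> adj_rel ipH ipK T3 v b ->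
  adj_rel ipK ipK T4 v c -> adj_rel ipHK ipHK T (u, v) (a + b, c).
Proof.
move=> h1 h3 h4 [x y] [dx _ dx' dy]; rewrite blk_app /ip_sum /= in dx dx' dy *.
by rewrite (ipDl hK) (h1 _ dx) (h3 _ dx') (h4 _ dy) addrA -(ipDr hH).
Qed.

(** Testing on [(x, 0)] and [(0, y)] separates the columns of [T]; [pair_adj] then separates [T1]
    from [T3] in the first column. *)
Lemma blk_adj_relE y z : adj_rel ipHK ipHK T y z -> exists a b,
  [/\ adj_rel ipH ipH T1 y.1 a, adj_rel ipH ipK T3 y.2 b, adj_rel ipK ipK T4 y.2 z.2 &
    z.1 = a + b].
Proof.
case: y z => u v [z1 z2] h.
have h' x y : dom T1 x -> dom T3 x -> dom T4 y ->
    ipH (app T1 x) u + (ipK (app T3 x) v + ipK (app T4 y) v) = ipH x z1 + ipK y z2.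
  by move=> dx dx' dy; have := h (x, y) (blk_dom dx dx' dy); rewrite blk_app /ip_sum /= (ipDl hK).
have d04 : dom T4 0 by case: l4.
have hl x : dom T1 x -> dom T3 x -> ipH (app T1 x) u + ipK (app T3 x) v = ipH x z1.
  move=> dx dx'; have := h' x 0 dx dx' d04.
  by rewrite (app0 l4) !(ip0l hK) !addr0.
have hr x : dom T3 x -> dom T1 x -> ipK (app T3 x) v + ipH (app T1 x) u = ipH x z1.
  by move=> dx dx'; rewrite addrC hl.
have [a [b [ra Ra Rb ab]]] := pair_adj hp hl.
have [b' [a' [rb Rb' Ra' ab']]] := pair_adj hp' hr.
(* [pair_adj] in the two orders gives two decompositions of [z.1]; their difference lies in both
   orthogonal ranges, so they agree. *)
have e : b' = b.
  have e : b' - b = a - a' by apply/eqP; rewrite subr_eq addrAC eq_sym subr_eq -ab ab' addrC.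
  have [y [dy yE]] : op_range T1a (b' - b).
    by rewrite e; apply: (subspaceB (range_subspace (adj_lin hH hH d1))).
  have [w [dw wE]] : op_range T3a (b' - b).
    by apply: (subspaceB (range_subspace (adj_lin hH hK d3))).
  apply/eqP; rewrite -subr_eq0; apply/eqP/(sqn_eq0 hH).
  by rewrite /sqn -{1}yE -wE (adj_adj_orth hp).
exists a, b; split=> //; first by rewrite -e.
move=> y dy; have d01 : dom T1 0 by case: l1.
have d03 : dom T3 0 by case: l3.
have := h' 0 y d01 d03 dy.
by rewrite (app0 l1) (app0 l3) !(ip0l hK) !(ip0l hH) !add0r.
Qed.

Lemma adj_rel_range3 x : dom T3 x -> adj_rel ipK ipK T4 (app T3 x) 0.
Proof.
by move=> dx y dy; rewrite (ip0r hK) (ip_sym0 hK) // p34 //; [exists x|exists y].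
Qed.

Lemma adj_rel_range4 y : dom T4 y -> adj_rel ipH ipK T3 (app T4 y) 0.
Proof. by move=> dy x dx; rewrite (ip0r hH) p34 //; [exists x|exists y]. Qed.

(** The cross terms [T3^* T4] and [T4^* T3] vanish because the ranges are orthogonal. *)
Lemma blk_adjmul x y : dom S x -> dom S4 y ->
  dom TaT (x, y) /\ app TaT (x, y) = (app S x, app S4 y).
Proof.
move=> [[dx dx'] [dz dz']] [dy dy'].
have := adj_val hHK blk_dense (blk_adj_rel (adj_app dx')
  (adj_relD hH hK (adj_app dz') (adj_rel_range4 dy))
  (adj_relD hK hK (adj_rel_range3 dz) (adj_app dy'))).
rewrite addr0 add0r -blk_app => -[d e].
by split; first by split=> //; apply: blk_dom.
Qed.

(** Subtracting [T4 y], where [T3^*] is 0, from [T3 x + T4 y] puts [T3 x] in the domain of [T3^*];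
    likewise for [T4 y]. *)
Lemma blk_adjmulE x y : dom TaT (x, y) -> dom S x /\ dom S4 y.
Proof.
move=> [[dx _ dz dy]]; rewrite blk_app => /adj_app/blk_adj_relE[a [b [/= ra rb rc _]]].
rewrite /= in dx dz dy.
have [d1x _] := adj_val hH d1 ra.
have := adj_relD hH hK rb (adj_relN hH hK (adj_rel_range4 dy)).
rewrite addrK => /(adj_val hH d3)[d3x _].
have := adj_relD hK hK (adj_relN hK hK (adj_rel_range3 dz)) rc.
by rewrite addrA addNr add0r => /(adj_val hK d4)[d4y _].
Qed.

Lemma blk_adjmul_mp h k x y : mp_rel ipH ipH S h x -> mp_rel ipK ipK S4 k y ->
  mp_rel ipHK ipHK TaT (h, k) (x, y).
Proof.
move=> [[dx cx] [b [ob hE]]] [[dy cy] [c [oc kE]]].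
have [dxy e] := blk_adjmul dx dy.
split.
  split=> // -[u v] [duv]; have [du dv] := blk_adjmulE duv.
  have [_ ->] := blk_adjmul du dv => -[u0 v0].
  by rewrite /ip_sum /= cx ?cy ?addr0 //; split.
exists (b, c); split; last by rewrite e hE kE.
move=> _ [[u v] [duv <-]]; have [du dv] := blk_adjmulE duv.
have [_ ->] := blk_adjmul du dv.
by rewrite /ip_sum /= ob ?oc ?addr0 //; [exists v|exists u].
Qed.

Lemma blk_mp_dom h k : dom (mp_inv ipHK ipHK TaT) (h, k) -> dom (mp_inv ipK ipK S4) k.
Proof.
move=> [a [b [[[u v] [duv <-]] [ob e]]]]; have [du dv] := blk_adjmulE duv.
have [_ eS] := blk_adjmul du dv; rewrite eS in e.
exists (app S4 v), b.2; split; first by exists v.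
split; last by case: b e {ob} => b c [].
move=> _ [w [dw <-]]; have lS := sum_lin hp.
have dS0 : dom S 0 by case: lS.
(* Testing against the image of [(0, w)] isolates the second component. *)
have [d0w e0w] := blk_adjmul dS0 dw.
have /ob : op_range TaT (app TaT (0, w)) by exists (0, w).
by rewrite e0w (app0 lS) /ip_sum (ip0l hH) add0r.
Qed.

Lemma cdual_blk : op_eq (cdual ipHK ipHK T)
  (blk (cdual ipH ipH T1) (zero_op K H) (cdual ipH ipK T3) (cdual ipK ipK T4)).
Proof.
have l44 := adjmul_lin hK hK l4 d4.
have k44 : closed_set ipK (kernel S4).
  have -> : kernel S4 = kernel T4.
    by apply/funext => x; apply/propext; apply: kernel_adjmul.
  exact: (kernel_closed hK c4).
have lTT := adjmul_lin hHK hHK blk_lin blk_dense.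
(* Since [S] is onto, [h] is unrestricted: both domains are governed by [k] alone. *)
have key h k : dom (mp_inv ipK ipK S4) k ->
  [/\ dom (cdual ipHK ipHK T) (h, k), dom (cdual ipH ipH T1) h, dom (cdual ipH ipK T3) h,
      dom (cdual ipK ipK T4) k &
      app (cdual ipHK ipHK T) (h, k) =
      (app (cdual ipH ipH T1) h, app (cdual ipH ipK T3) h + app (cdual ipK ipK T4) k)].
  move=> dk; have m4 := mp_app hK l44 k44 dk.
  set y := app (mp_inv ipK ipK S4) k in m4.
  (* One decomposition of [h] yields three Moore-Penrose values: [x1 + x3] for [S], [x1] for [S1]
     and [x3] for [S3]. *)
  have [x1 [x3 [[dx1 kx1] [dx3 kx3] hE]]] := sum_surj hp h.
  have mS : mp_rel ipH ipH S h (x1 + x3) by rewrite hE; apply: (sum_mp hp).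
  have m1 : mp_rel ipH ipH S1 h x1 by rewrite hE; apply: (adjmul_mp hp).
  have m3 : mp_rel ipH ipH S3 h x3 by rewrite hE addrC; apply: (adjmul_mp hp').
  have [dM1 eM1] := mp_val hH hH (adjmul_lin hH hH l1 d1) m1.
  have [dM3 eM3] := mp_val hH hH (adjmul_lin hH hK l3 d3) m3.
  have [dMT eMT] := mp_val hHK hHK lTT (blk_adjmul_mp mS m4).
  have [dx1' _] := dx1; have [dx3' _] := dx3.
  have [d13 e13] := kx1; have [d31 e31] := kx3.
  have [[[dy _] _] _] := m4.
  have dT : dom T (x1 + x3, y) by apply: blk_dom => //; [apply: (domD l1)|apply: (domD l3)].
  split.
  - by split=> //; rewrite eMT.
  - by split=> //; rewrite eM1.
  - by split=> //; rewrite eM3.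
  - by split.
  change (app T (app (mp_inv ipHK ipHK TaT) (h, k)) =
    (app T1 (app (mp_inv ipH ipH S1) h),
     app T3 (app (mp_inv ipH ipH S3) h) + app T4 y)).
  by rewrite eMT eM1 eM3 blk_app (appD l1) // (appD l3) // e31 e13 addr0 add0r.
split=> -[h k].
  split=> [[/blk_mp_dom/(key h)[] _ ? ? ? _ _]|[_ _ _ [dk _]]]; first by split.
  by have [] := key h k dk.
move=> [/blk_mp_dom/(key h)[_ _ _ _ ->] _].
by change ((app (cdual ipH ipH T1) h, app (cdual ipH ipK T3) h + app (cdual ipK ipK T4) k) =
  (app (cdual ipH ipH T1) h + 0, app (cdual ipH ipK T3) h + app (cdual ipK ipK T4) k));
  rewrite addr0.
Qed.

Lemma mp_blk : op_eq (mp_inv ipHK ipHK T)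
  (blk (mp_inv ipH ipH T1) (mp_inv ipH ipK T3) (zero_op H K) (mp_inv ipK ipK T4)).
Proof.
split=> -[h k].
  split=> _; first by split=> //; apply: mp_total.
  exact: (mp_total _ hHK blk_lin blk_range_closed).
move=> _; have m1 := mp_rel_total hH hH l1 c1 r1 h.
have m3 := mp_rel_total hH hK l3 c3 r3 k; have m4 := mp_rel_total hK hK l4 c4 r4 k.
have [_ ->] := mp_val hHK hHK blk_lin (blk_mp m1 m3 m4).
by rewrite -[X in (_, X)]add0r.
Qed.

End BlockOperator.

Theorem theorem2p26 (R : realType) (H K : lmodType R[i])
  (ipH : H -> H -> R[i]) (ipK : K -> K -> R[i])
  (T1 : op H H) (T3 : op H K) (T4 : op K K) :
  is_hilbert ipH -> is_hilbert ipK ->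
  linop T1 -> linop T3 -> linop T4 ->
  densely_defined ipH T1 -> densely_defined ipH T3 -> densely_defined ipK T4 ->
  closed_op ipH ipH T1 -> closed_op ipH ipK T3 -> closed_op ipK ipK T4 ->
  closed_range ipH T1 -> closed_range ipK T3 -> closed_range ipK T4 ->
  orth_dsum_full ipH (op_range (adjoint ipH ipH T1)) (op_range (adjoint ipH ipK T3)) ->
  perp ipK (op_range T3) (op_range T4) ->
  let S := op_add (op_mul (adjoint ipH ipH T1) T1) (op_mul (adjoint ipH ipK T3) T3) in
  dense ipH (dom S) ->
  let ipHK := ip_sum ipH ipK in
  let T := blk T1 (zero_op K H) T3 T4 in
  let Tdag := mp_inv ipHK ipHK T in
  let M1 := blk (mp_inv ipH ipH T1) (mp_inv ipH ipK T3) (zero_op H K) (mp_inv ipK ipK T4) in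
  let ST1 := op_mul (mp_inv ipH ipH S) (adjoint ipH ipH T1) in
  let ST3 := op_mul (mp_inv ipH ipH S) (adjoint ipH ipK T3) in
  let M2 := blk (op_closure ipH ipH ST1) (op_closure ipK ipH ST3) (zero_op H K) (mp_inv ipK ipK T4) in
  (* T^dagger exists: T is a densely defined closed operator with closed op_range *)
  [/\ densely_defined ipHK T, closed_op ipHK ipHK T & closed_range ipHK T] /\
  op_eq Tdag M1 /\ closable ipH ipH ST1 /\ closable ipK ipH ST3 /\ op_eq M1 M2 /\
  op_eq (cdual ipHK ipHK T)
        (blk (cdual ipH ipH T1) (zero_op K H) (cdual ipH ipK T3) (cdual ipK ipK T4)).
Proof.
move=> hH hK l1 l3 l4 d1 d3 d4 c1 c3 c4 r1 r3 r4 hD p34 S dS ipHK T Tdag M1 ST1 ST3 M2.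
have hp : orth_pair ipH ipH ipK T1 T3 by [].
have hp' := orth_pair_sym hp.
have cl3 := sum_mp_closable hp'; have e3 := sum_mp_closureE hp'.
(* The swapped pair produces the sum with [T3^* T3] first. *)
rewrite op_addC in cl3 e3.
split; first by split; [exact: blk_dense|exact: blk_closed|exact: blk_range_closed].
split; first exact: mp_blk.
split; first exact: sum_mp_closable.
split; first exact: cl3.
split; first exact: (blk_op_eq _ _ (sum_mp_closureE hp) e3).
exact: cdual_blk.
Qed.
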